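(* Let $X_1, X_2,\ldots$ be i.i.d. copies of an absolutely continuous real random variable $X$, let $a_n > 0$ and $b_n\in\mathbb{R}$ be normalizing constants, and write $M_n = \max(X_1,\ldots,X_n)$ and $N_n = (M_n - b_n)/a_n$. Then the max-score functions satisfy $$\Theta_{N_n}(z) = \log(n a_n) + \Theta_X(a_n z + b_n),$$ $$\Theta_{N_n}(N_n) = \log(n a_n) + \Theta_X(M_n).$$
   Context: For an absolutely continuous real random variable $Z$ with distribution function $F_Z(z)=\mathbb{P}(Z\le z)$ and density $f_Z = F_Z'$, the max-score function is $\Theta_Z(z) := \log\left(f_Z(z)/F_Z(z)\right)$, at points $z$ where this is defined. Logarithms are natural. *)

(* Defs.v *)
From HB Require Import structures.
From mathcomp Require Import all_boot all_order all_algebra finmap.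
From mathcomp Require Import all_classical all_reals all_analysis.
From mathcomp Require Import measurable_realfun.

Set Implicit Arguments.
Unset Strict Implicit.
Unset Printing Implicit Defensive.

Import Order.TTheory GRing.Theory Num.Theory.
Import numFieldNormedType.Exports.

Local Open Scope classical_set_scope.
Local Open Scope ring_scope.

Section max_score.
Context d (T : measurableType d) (R : realType) (P : probability T R).

Definition absolutely_continuous (Z : {RV P >-> R}) : Prop :=
  distribution P Z `<< (@lebesgue_measure R).

Definition dist_fun (Z : {RV P >-> R}) (z : R) : R := fine (cdf Z z).

Definition density (Z : {RV P >-> R}) : R -> R := derive1 (dist_fun Z).

(* [derive1] and [ln] are total in the library, so the domain of the score is
   tracked explicitly: [None] where [F] has no derivative or where the
   logarithm has no real value. *)
Definition max_score_defined (Z : {RV P >-> R}) (z : R) : Prop :=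
  [/\ derivable (dist_fun Z) z 1, 0 < dist_fun Z z & 0 < density Z z].

Definition max_score (Z : {RV P >-> R}) (z : R) : option R :=
  if `[< max_score_defined Z z >] then Some (ln (density Z z / dist_fun Z z))
  else None.

Definition mutually_independent (X : nat -> {RV P >-> R}) : Prop :=
  forall (J : {fset nat}) (B : nat -> set R),
    (forall i, i \in J -> measurable (B i)) ->
    P (\bigcap_(i in [set` J]) (X i @^-1` B i)) =
    (\prod_(i <- J) P (X i @^-1` B i))%E.

End max_score.

Definition iid_copies d d' (T : measurableType d) (T' : measurableType d')
    (R : realType) (P : probability T R) (Q : probability T' R)
    (Xs : nat -> {RV P >-> R}) (X : {RV Q >-> R}) : Prop :=
  mutually_independent Xs /\
  forall (i : nat) (B : set R), measurable B ->
    distribution P (Xs i) B = distribution Q X B.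

Section sample_max.
Context d (T : measurableType d) (R : realType) (P : probability T R).

(* Sequences are indexed from 0: [Xs i] is the [i+1]-st variable.  For [0 < n]
   the default [Xs 0] is one of the [n] variables, so this is their maximum. *)
Definition sample_max (Xs : nat -> {RV P >-> R}) (n : nat) (t : T) : R :=
  \big[Num.max/Xs 0 t]_(i < n) Xs i t.

Lemma measurable_sample_max (Xs : nat -> {RV P >-> R}) (n : nat) :
  measurable_fun [set: T] (sample_max Xs n).
Proof.
rewrite /sample_max.
suff mr (r : seq 'I_n) :
    measurable_fun [set: T] (fun t => \big[Num.max/Xs 0 t]_(i <- r) Xs i t).
  exact: mr.
elim: r => [|i r IH].
  by under eq_fun do rewrite big_nil; exact: measurable_funPT.
under eq_fun do rewrite big_cons.
exact: (measurable_maxr (measurable_funPT (Xs i)) IH).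
Qed.

HB.instance Definition _ (Xs : nat -> {RV P >-> R}) (n : nat) :=
  isMeasurableFun.Build _ _ _ _ (sample_max Xs n) (measurable_sample_max Xs n).

Definition normalize (Z : {RV P >-> R}) (a b : R) (t : T) : R := (Z t - b) / a.

Lemma measurable_normalize (Z : {RV P >-> R}) (a b : R) :
  measurable_fun [set: T] (normalize Z a b).
Proof. by apply: measurable_funM => //; exact: measurable_funB. Qed.

HB.instance Definition _ (Z : {RV P >-> R}) (a b : R) :=
  isMeasurableFun.Build _ _ _ _ (normalize Z a b) (measurable_normalize Z a b).

End sample_max.

(* Main.v *)
Require Import Defs.
From HB Require Import structures.
From mathcomp Require Import all_boot all_order all_algebra finmap.
From mathcomp Require Import all_classical all_reals all_analysis.
From mathcomp Require Import ring.

Set Implicit Arguments.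
Unset Strict Implicit.
Unset Printing Implicit Defensive.

Import Order.TTheory GRing.Theory Num.Theory.
Import numFieldNormedType.Exports.

Local Open Scope classical_set_scope.
Local Open Scope ring_scope.

(** Write F for the distribution function of X. A maximum is at most x exactly
    when every sampled value is, so independence and equality in law give the
    distribution function F(x)^n for M_n ([dist_fun_sample_max]), and the
    increasing affine change of variable gives F(a z + b)^n for N_n
    ([dist_fun_normalize]). By the chain rule
    ([is_derive_affine_power]) the density of N_n at z is
    n F(w)^(n-1) f(w) a with w = a z + b; dividing by F(w)^n leaves
    n a f(w) / F(w), and taking logarithms gives the first identity.
    The second identity is the first one at z = N_n(t), where
    a N_n(t) + b = M_n(t) ([normalizeK]).

    Since scores are partial, the two sides must also have the same domain.
    That the score of N_n is defined where that of X is follows from the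
    chain rule. The converse needs F to be differentiable at w as soon as F^n
    is: where F^n is positive, F is recovered from it by taking an n-th root,
    a differentiable operation on positive reals
    ([derivable_affine_power_root]). *)

Section rv_facts.
Context d (T : measurableType d) (R : realType) (P : probability T R).

Lemma cdf_dist_fun (Z : {RV P >-> R}) z : cdf Z z = (dist_fun Z z)%:E.
Proof. by rewrite /dist_fun fineK// fin_num_measure. Qed.

Lemma dist_fun_ge0 (Z : {RV P >-> R}) z : 0 <= dist_fun Z z.
Proof. by rewrite fine_ge0 ?cdf_ge0. Qed.

Lemma normalizeK (Z : {RV P >-> R}) a b t :
  0 < a -> a * normalize Z a b t + b = Z t.
Proof. by move=> a0; rewrite /normalize mulrC divfK ?gt_eqF// subrK. Qed.

Lemma dist_fun_normalize (Z : {RV P >-> R}) a b z : 0 < a ->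
  dist_fun (normalize Z a b : {RV P >-> R}) z = dist_fun Z (a * z + b).
Proof.
move=> a0; congr (fine (P _)); apply/seteqP; split=> t /=;
  rewrite !in_itv/= /normalize ler_pdivrMr// mulrC lerBlDr //.
Qed.

Lemma sample_max_le (Xs : nat -> {RV P >-> R}) n t x : (0 < n)%N ->
  sample_max Xs n t <= x <-> (forall i, (i < n)%N -> Xs i t <= x).
Proof.
move=> n0; split=> [/bigmax_leP[_ h] i ni|h]; first exact: (h (Ordinal ni)).
by apply/bigmax_leP; split=> [|i _]; apply: h.
Qed.

End rv_facts.

(** The event that the maximum is at most x is the intersection of the events
    that the individual variables are, whose probabilities multiply by
    independence and coincide by equality in law. *)
Lemma dist_fun_sample_max d d' (T : measurableType d) (T' : measurableType d')
    (R : realType) (P : probability T R) (Q : probability T' R)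
    (Xs : nat -> {RV P >-> R}) (X : {RV Q >-> R}) n x :
  iid_copies Xs X -> (0 < n)%N ->
  dist_fun (sample_max Xs n : {RV P >-> R}) x = dist_fun X x ^+ n.
Proof.
move=> [indep same] n0.
pose J := seq_fset tt (iota 0 n).
have JE i : (i \in J) = (i < n)%N by rewrite seq_fsetE mem_iota add0n.
have maxE : sample_max Xs n @^-1` `]-oo, x] =
    \bigcap_(i in [set` J]) (Xs i @^-1` `]-oo, x]).
  apply/seteqP; split=> t /=.
    by rewrite in_itv/= => /sample_max_le h i /=; rewrite JE in_itv/=; exact: h.
  move=> h; rewrite in_itv/=; apply/sample_max_le => // i ni.
  by have /= := h i; rewrite JE in_itv/=; exact.
apply: EFin_inj; rewrite -cdf_dist_fun /cdf /distribution /pushforward maxE.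
rewrite indep => [|i _]; last exact: measurable_itv.
rewrite (eq_bigr (fun=> (dist_fun X x)%:E)) => [|i _]; last first.
  by rewrite -cdf_dist_fun -[RHS](same i)//; exact: measurable_itv.
rewrite prodEFin big_const_seq count_predT iter_mulr_1.
by rewrite size_seq_fset undup_id ?iota_uniq// size_iota.
Qed.

(** If G is the distribution function of X, the function H below is the one of
    the normalized maximum. *)
Section affine_power.
Context (R : realType) (G : R -> R) (a b : R) (n : nat).
Context (a_gt0 : 0 < a) (n_gt0 : (0 < n)%N).
Let H z := G (a * z + b) ^+ n.

Lemma is_derive_affine (p q z : R) : is_derive z 1 (fun y => p * y + q) p.
Proof.
have : is_derive z 1 (p \*: @id R + cst q) (p *: 1 + 0) by exact: is_deriveD.
by rewrite addr0 [_ *: _]mulr1.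
Qed.

Lemma is_derive_affine_power z g : is_derive (a * z + b) 1 G g ->
  is_derive z 1 H (n%:R * G (a * z + b) ^+ n.-1 * g * a).
Proof.
move=> dG.
have -> : H = (G ^+ n) \o (fun y => a * y + b).
  by apply/funext => y; rewrite /H/= exprfctE.
exact: (@is_derive1_comp _ _ (fun y => a * y + b) z _ _
  (is_deriveX n dG) (is_derive_affine a b z)).
Qed.

(** Inverting the affine map and taking n-th roots expresses G through H,
    so the chain rule applies to this expression. The positivity of H z keeps
    away from 0, where an n-th root with n > 1 is not differentiable. *)
Lemma derivable_affine_power_root z : (forall w, 0 <= G w) ->
  0 < H z -> derivable H z 1 -> derivable G (a * z + b) 1.
Proof.
move=> G0 Hz0 /derivableP dH.
have zE : a^-1 * (a * z + b) - b / a = z.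
  by rewrite mulrDr mulKf ?gt_eqF// mulrC addrK.
have GE : G = (fun w => H (a^-1 * w - b / a) `^ n%:R^-1).
  apply/funext => w; rewrite /H mulrBr mulVKf ?gt_eqF//.
  rewrite [a * (b / a)]mulrC divfK ?gt_eqF// subrK.
  by rewrite -powR_mulrn// -powRrM divff ?powRr1// pnatr_eq0 -lt0n.
have dL := is_derive_affine a^-1 (- (b / a)) (a * z + b).
(* The composition lemma expects H to be differentiated at the image of
   a * z + b under the inverse affine map. *)
rewrite GE; rewrite -zE in dH Hz0.
have dHL := @is_derive1_comp _ H (fun w => a^-1 * w - b / a) _ _ _ dH dL.
by have [] := @is_derive1_comp _ (@powR R ^~ n%:R^-1)
  (H \o (fun w => a^-1 * w - b / a)) _ _ _
  (is_derive1_powR n%:R^-1 Hz0) dHL.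
Qed.

End affine_power.

(** The identity of scores as partial functions: the two domains agree because
    differentiability, positivity of the distribution function and positivity
    of the density pass between F at a z + b and the n-th power in both
    directions, and on the common domain the powers of F cancel. *)
Lemma max_score_normalize_max (R : realType) d d'
    (T : measurableType d) (T' : measurableType d')
    (P : probability T R) (Q : probability T' R)
    (X : {RV Q >-> R}) (Xs : nat -> {RV P >-> R}) (a b : R) n z :
  let N : {RV P >-> R} := normalize (sample_max Xs n : {RV P >-> R}) a b in
  iid_copies Xs X -> 0 < a -> (0 < n)%N ->
  max_score N z =
  omap (fun s => ln (n%:R * a) + s) (max_score X (a * z + b)).
Proof.
move=> N iid a0 n0.
set G := dist_fun X; set w := a * z + b.
have NE : dist_fun N = fun y => G (a * y + b) ^+ n.
  by apply/funext => y; rewrite dist_fun_normalize// (dist_fun_sample_max _ iid).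
have Gge0 y : 0 <= G y by exact: dist_fun_ge0.
have densE : derivable G w 1 ->
    density N z = n%:R * G w ^+ n.-1 * density X w * a.
  move=> /derivableP dG; rewrite /density NE !derive1E.
  by have [_ ->] := is_derive_affine_power n dG.
have nR0 : 0 < n%:R :> R by rewrite ltr0n.
have definedE : max_score_defined N z <-> max_score_defined X w.
  split=> -[dF F0 f0].
    have dG : derivable G w 1.
      move: dF F0; rewrite NE => dH H0.
      exact: (derivable_affine_power_root a0 n0 Gge0 H0 dH).
    have G0 : 0 < G w.
      by move: F0; rewrite NE lt0r expf_eq0 n0/= => /andP[Gn0 _]; rewrite lt0r Gn0/=.
    split=> //; move: f0; rewrite densE//.
    by rewrite pmulr_lgt0// pmulr_rgt0// mulr_gt0// exprn_gt0.
  split; rewrite ?densE//.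
  - by rewrite NE; have [] := is_derive_affine_power n (derivableP dF).
  - by rewrite NE exprn_gt0.
  - by rewrite !mulr_gt0// exprn_gt0.
rewrite /max_score (asbool_equiv_eq definedE).
case: asboolP => //= -[dG G0 g0]; congr Some.
rewrite densE// NE -/G -/w -lnM ?posrE ?divr_gt0 ?mulr_gt0//.
(* Writing n as a successor turns F^n into F * F^(n-1), so that F^(n-1) cancels
   as an atom. *)
congr ln; rewrite -(prednK n0) exprS/=; field.
by rewrite ?expf_neq0 ?gt_eqF.
Qed.

Theorem lemma1p3 (R : realType) (d d' : measure_display)
    (T : measurableType d) (T' : measurableType d')
    (P : probability T R) (Q : probability T' R)
    (X : {RV Q >-> R}) (Xs : nat -> {RV P >-> R}) (a b : nat -> R)
    (X_ac : absolutely_continuous X) (Xs_iid : iid_copies Xs X)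
    (a_gt0 : forall n : nat, (0 < n)%N -> 0 < a n)
    (n : nat) (n_gt0 : (0 < n)%N) :
  let M : {RV P >-> R} := sample_max Xs n in
  let N : {RV P >-> R} := normalize M (a n) (b n) in
  (forall z : R,
     max_score N z =
     omap (fun s : R => ln (n%:R * a n) + s) (max_score X (a n * z + b n))) /\
  (forall t : T,
     max_score N (N t) =
     omap (fun s : R => ln (n%:R * a n) + s) (max_score X (M t))).
Proof.
move=> M N; have an0 := a_gt0 _ n_gt0; split=> [z|t].
  exact: max_score_normalize_max.
by rewrite -(normalizeK M (b n) t an0); exact: max_score_normalize_max.
Qed.
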